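(* Let $T>0$. For each $0<t<T$ and every real number $c<\max\left(\frac1t,\frac1{T-t}\right)$ there is a sample continuous stationary process $\mathbf{X}=(X(s),s\in\mathbb{R})$ satisfying Assumptions $\mathrm{U}_T$ and L for which the right continuous version of the density $f_{\mathbf{X},T}$ of the supremum location satisfies $f_{\mathbf{X},T}(t)>c$.
   Context: Processes are real-valued. $\tau_{\mathbf{X},T}=\min\{t\in[0,T]: X(t)=\sup_{0\le s\le T}X(s)\}$ is the (leftmost) location of the supremum of $\mathbf{X}$ in $[0,T]$, and $F_{\mathbf{X},T}$ is its law. For every stationary sample continuous process, the restriction of $F_{\mathbf{X},T}$ to $(0,T)$ is absolutely continuous, the cumulative distribution function of $F_{\mathbf{X},T}$ has a right derivative at every point of $(0,T)$, and $f_{\mathbf{X},T}$ denotes the version of the density on $(0,T)$ given by this right derivative; it is right continuous. Assumption $\mathrm{U}_T$: with probability $1$ there is only one point of $[0,T]$ at which $X$ attains $\sup_{0\le s\le T}X(s)$. Assumption L: $\lim_{\varepsilon\downarrow0}\frac1\varepsilon P(\mathbf{X}\text{ has a local maximum in }(0,\varepsilon))<\infty$ (the limit always exists in $[0,\infty]$). A local maximum is a point $u$ with $X(s)\le X(u)$ for all $s$ in some neighbourhood of $u$ (not necessarily strict). *)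

(* Defs.v *)
From HB Require Import structures.
From mathcomp Require Export all_boot all_order all_algebra.
From mathcomp Require Export all_classical all_reals all_analysis.
Export Order.TTheory GRing.Theory Num.Theory.
Export numFieldNormedType.Exports.

Set Implicit Arguments.
Unset Strict Implicit.
Unset Printing Implicit Defensive.

#[global] Open Scope classical_set_scope.
#[global] Open Scope ring_scope.

Definition sample_continuous d (Omega : measurableType d) (R : realType)
    (P : probability Omega R) (X : R -> {RV P >-> R}) : Prop :=
  forall w, continuous (fun s => X s w).

Definition fdd d (Omega : measurableType d) (R : realType)
    (P : probability Omega R) (X : R -> {RV P >-> R}) (n : nat)
    (s : 'I_n -> R) : set (n.-tuple R) -> \bar R :=
  pushforward P (fun w => [tuple X (s i) w | i < n]).

Definition stationary d (Omega : measurableType d) (R : realType)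
    (P : probability Omega R) (X : R -> {RV P >-> R}) : Prop :=
  forall (n : nat) (s : 'I_n -> R) (h : R) (A : set (n.-tuple R)),
    measurable A -> fdd X (fun i => s i + h) A = fdd X s A.

Definition argsup d (Omega : measurableType d) (R : realType)
    (P : probability Omega R) (X : R -> {RV P >-> R}) (T : R) (w : Omega) :
    set R :=
  [set s | s \in `[0, T] /\
           X s w = sup [set X s' w | s' in [set` `[0, T]]]].

(* For continuous paths and T >= 0 this infimum is a minimum: see
   sup_location_min below. *)
Definition sup_location d (Omega : measurableType d) (R : realType)
    (P : probability Omega R) (X : R -> {RV P >-> R}) (T : R) (w : Omega) : R :=
  inf (argsup X T w).

Definition sup_location_law d (Omega : measurableType d) (R : realType)
    (P : probability Omega R) (X : R -> {RV P >-> R}) (T : R) :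
    set R -> \bar R :=
  pushforward P (sup_location X T).

Definition sup_location_cdf d (Omega : measurableType d) (R : realType)
    (P : probability Omega R) (X : R -> {RV P >-> R}) (T x : R) : R :=
  fine (sup_location_law X T `]-oo, x]).

Definition sup_location_rdiff d (Omega : measurableType d) (R : realType)
    (P : probability Omega R) (X : R -> {RV P >-> R}) (T t h : R) : R :=
  h^-1 * (sup_location_cdf X T (t + h) - sup_location_cdf X T t).

(* The right continuous version of the density of the law on ]0, T[ is the
   right derivative of the distribution function.  [lim] is a junk value when
   the limit does not exist, so uses are to be paired with a [cvg]. *)
Definition sup_location_density d (Omega : measurableType d) (R : realType)
    (P : probability Omega R) (X : R -> {RV P >-> R}) (T t : R) : R :=
  lim (sup_location_rdiff X T t h @[h --> 0^'+]).

Definition assumption_U d (Omega : measurableType d) (R : realType)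
    (P : probability Omega R) (X : R -> {RV P >-> R}) (T : R) : Prop :=
  {ae P, forall w, exists! s, argsup X T w s}.

Definition has_local_max_in d (Omega : measurableType d) (R : realType)
    (P : probability Omega R) (X : R -> {RV P >-> R}) (a b : R) : set Omega :=
  [set w | exists2 u, a < u < b & \forall s \near u, X s w <= X u w].

Definition assumption_L d (Omega : measurableType d) (R : realType)
    (P : probability Omega R) (X : R -> {RV P >-> R}) : Prop :=
  let q (e : R) : \bar R := ((e^-1)%:E * P (has_local_max_in X 0 e))%E in
  cvg (q e @[e --> 0^'+]) /\ (lim (q e @[e --> 0^'+]) < +oo)%E.

Lemma sup_location_min d (Omega : measurableType d) (R : realType)
    (P : probability Omega R) (X : R -> {RV P >-> R}) (T : R) (w : Omega) :
  0 <= T -> sample_continuous X ->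
  argsup X T w (sup_location X T w) /\
  forall s, argsup X T w s -> sup_location X T w <= s.
Proof.
move=> T0 Xc; set f := fun s => X s w.
have fc : {within `[0, T], continuous f}.
  by apply: continuous_subspaceT => x; exact: Xc.
set S := sup [set X s w | s in [set` `[0, T]]].
have [c cT cmax] := EVT_max T0 fc.
have A0 : argsup X T w c.
  split=> //; apply/eqP; rewrite eq_le; apply/andP; split.
    apply: ub_le_sup; last by exists c.
    by exists (f c) => _ [s sT <-]; exact: cmax.
  apply: ge_sup; first by exists (f c), c.
  by move=> _ [s sT <-]; exact: cmax.
have lb0 : lbound (argsup X T w) 0.
  by move=> s [] /=; rewrite in_itv /= => /andP[].
have hlb : has_inf (argsup X T w) by split; [exists c | exists 0].
have lbI s : argsup X T w s -> sup_location X T w <= s.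
  by move=> As; apply: ge_inf => //; exists 0.
split=> //.
have AE : argsup X T w = `[0, T] `&` f @^-1` [set S].
  by apply/seteqP; split=> s [].
have clA : closed (argsup X T w).
  rewrite AE; apply: closedI; first exact: interval_closed.
  apply: preimage_closed; first by move=> x _; exact: Xc.
  exact: closed_eq.
rewrite ((closure_id _).1 clA) => B /nbhs_ballP[e /= e0 eB].
have [s As sI] := inf_adherent e0 hlb.
exists s; split=> //; apply: eB; rewrite /ball /= distrC ger0_norm.
  by rewrite ltrBlDl.
by rewrite subr_ge0 lbI.
Qed.

(* Main.v *)
(* The process is [X s w = g (s + w)] with [w] uniform on [0, L] and [g] an
   [L]-periodic function, which makes it stationary.  Let [r = min t (T - t)]
   and [delta > r] close to [r].  In one period [g] is a comb of [n] peaks at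
   mutual distance [delta], followed by a gap longer than [T], of heights that
   slowly decrease if [r = t] and slowly increase if [r = T - t].  If a peak is
   at time [s], for [s] slightly larger than [t], then the peaks of the window
   [0, T] that lie on one side of it are lower, and on the other side there is
   none, as [delta > r] and as the gap is too long.  Hence every peak is the
   location of the supremum at such times, and the density at [t] is [n / L],
   where [L = n delta + T]; it tends to [1 / delta] as [n] grows.

   [g] is an upper envelope of tents [a - |x - q|], attained at every point, so
   its local maxima are tops of tents. *)
From HB Require Import structures.
Require Import Defs.
From mathcomp Require Import measurable_realfun.
From mathcomp Require Import ring lra.

Set Implicit Arguments.
Unset Strict Implicit.
Unset Printing Implicit Defensive.

(** * Envelopes of tents *)

Section tents.
Variables (R : realType) (I : Type) (q a : I -> R) (g : R -> R).
Hypothesis tent_le : forall i x, a i - `|x - q i| <= g x.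
Hypothesis tent_attained : forall x, exists i, g x = a i - `|x - q i|.

Lemma tent_lipschitz x y : g x <= g y + `|x - y|.
Proof.
have [i ->] := tent_attained x; have := tent_le i y.
have := ler_normD (y - x) (x - q i).
rewrite (distrC y x) (_ : y - x + (x - q i) = y - q i); last by ring.
lra.
Qed.

Lemma tent_continuous : continuous g.
Proof.
move=> x; apply/cvgrPdist_lt => e e0; near=> y.
have xy : `|x - y| < e by near: y; exact: cvgr_dist_lt.
have := tent_lipschitz x y; have := tent_lipschitz y x; rewrite (distrC y x).
by move=> h1 h2; rewrite ltr_norml; apply/andP; split; lra.
Unshelve. all: by end_near. Qed.

(** A tent with its top to the right of [u] rises with slope 1 at [u] and lies below [g], so [g]
    would exceed [g u] just to the right of [u]. *)
Lemma active_le_right_max i u e : 0 < e ->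
  (forall x, u <= x <= u + e -> g x <= g u) -> g u = a i - `|u - q i| ->
  q i <= u.
Proof.
move=> e0 umax gu; rewrite leNgt; apply/negP => uq.
pose x := Num.min (u + e) (q i).
have xq : x <= q i by rewrite ge_min lexx orbT.
have ux : u < x by rewrite lt_min uq ltrDl e0.
have := umax x; rewrite (ltW ux) ge_min lexx /= => /(_ isT).
have := tent_le i x; move: gu; rewrite !ler0_norm ?subr_le0 ?(ltW uq)//.
lra.
Qed.

Lemma active_ge_left_max i u e : 0 < e ->
  (forall x, u - e <= x <= u -> g x <= g u) -> g u = a i - `|u - q i| ->
  u <= q i.
Proof.
move=> e0 umax gu; rewrite leNgt; apply/negP => uq.
pose x := Num.max (u - e) (q i).
have xq : q i <= x by rewrite le_max lexx orbT.
have ux : x < u by rewrite gt_max uq ltrBlDr ltrDl e0.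
have := umax x; rewrite (ltW ux) le_max lexx /= => /(_ isT).
have := tent_le i x; move: gu; rewrite !ger0_norm ?subr_ge0 ?(ltW uq)//.
lra.
Qed.

Lemma local_max_tent u : (\forall x \near u, g x <= g u) ->
  exists i, u = q i /\ g u = a i.
Proof.
move=> /nbhs_ballP[e /= e0 emax]; have [i gu] := tent_attained u.
have e20 : 0 < e / 2 by lra.
have ui : u = q i.
  apply/eqP; rewrite eq_le (active_ge_left_max e20 _ gu) /=; last first.
    by move=> x xu; apply: emax; rewrite /ball /= ger0_norm; lra.
  apply: (active_le_right_max e20 _ gu) => x xu.
  by apply: emax; rewrite /ball /= ler0_norm; lra.
by exists i; split=> //; rewrite gu ui subrr normr0 subr0.
Qed.

(** The inequality form of [argsup], free of [sup], for the path [s |-> g (s + w)]. *)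
Definition window_max (T w s : R) :=
  s \in `[0, T] /\ forall s', s' \in `[0, T] -> g (s' + w) <= g (s + w).

Lemma window_max_local_max T w s : 0 < s < T -> window_max T w s ->
  \forall x \near s + w, g x <= g (s + w).
Proof.
move=> /andP[s0 sT] [_ smax].
apply/nbhs_ballP; exists (Num.min s (T - s)) => /=.
  by rewrite lt_min s0 subr_gt0.
move=> x; rewrite /ball /= lt_min !ltr_norml => /andP[/andP[? ?] /andP[? ?]].
by rewrite -(subrK w x); apply: smax; rewrite in_itv /=; lra.
Qed.

Lemma window_max_interior T w s : 0 < s < T -> window_max T w s ->
  exists i, s + w = q i /\ g (s + w) = a i.
Proof. by move=> sT wmax; exact/local_max_tent/(window_max_local_max sT). Qed.

(* Two maxima in one window: each of them is the top of a tent or sits at an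
   end of the window on the descending side of a tent, and the equality of
   the two values then determines [w]. *)
Lemma two_window_max T w x y : x < y -> window_max T w x -> window_max T w y ->
  (forall i k, a i = a k -> q i < q k -> T < q k - q i) ->
  exists i k, [\/ w = q i + a i - a k, w = q k - T + a i - a k |
     w = (a i + q i - a k + q k - T) / 2].
Proof.
move=> xy [xT xmax] [yT ymax] sep.
move: (xT) (yT); rewrite !in_itv /= => /andP[x0 xT'] /andP[y0 yT'].
have gxy : g (x + w) = g (y + w) by apply/eqP; rewrite eq_le ymax// xmax.
have [i gi] := tent_attained (x + w); have [k gk] := tent_attained (y + w).
have yx0 : 0 < y - x by lra.
(* Both maxima bound [g] on the segment between them, so the tent active at [x] has its top to the
   left and the one active at [y] to the right. *)
have qi : q i <= x + w.
  apply: (active_le_right_max yx0 _ gi) => z zx.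
  by rewrite -(subrK w z); apply: xmax; rewrite in_itv /=; lra.
have qk : y + w <= q k.
  apply: (active_ge_left_max yx0 _ gk) => z zx.
  by rewrite -(subrK w z); apply: ymax; rewrite in_itv /=; lra.
move: gi gk; rewrite ger0_norm ?subr_ge0// ler0_norm ?subr_le0// => gi gk.
exists i, k.
(* A maximum interior to the window also satisfies the opposite inequality and is a top. If at least
   one maximum sits at an end, [gxy] can be solved for [w]. *)
have [xE|x_gt0] := eqVneq x 0; have [yE|yT_lt] := eqVneq y T.
- by apply: Or33; lra.
- have y_lt : 0 < T - y by rewrite subr_gt0 lt_neqAle yT_lt.
  have gk' : g (y + w) = a k - `|y + w - q k| by rewrite ler0_norm; lra.
  suff : q k <= y + w by move=> ?; apply: Or31; lra.
  apply: (active_le_right_max y_lt _ gk') => z zx.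
  by rewrite -(subrK w z); apply: ymax; rewrite in_itv /=; lra.
- have x_gt : 0 < x by rewrite lt_neqAle eq_sym x_gt0.
  have gi' : g (x + w) = a i - `|x + w - q i| by rewrite ger0_norm; lra.
  suff : x + w <= q i by move=> ?; apply: Or32; lra.
  apply: (active_ge_left_max x_gt _ gi') => z zx.
  by rewrite -(subrK w z); apply: xmax; rewrite in_itv /=; lra.
have y_lt : 0 < T - y by rewrite subr_gt0 lt_neqAle yT_lt.
have x_gt : 0 < x by rewrite lt_neqAle eq_sym x_gt0.
have gk' : g (y + w) = a k - `|y + w - q k| by rewrite ler0_norm; lra.
have gi' : g (x + w) = a i - `|x + w - q i| by rewrite ger0_norm; lra.
have h1 : q k <= y + w.
  apply: (active_le_right_max y_lt _ gk') => z zx.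
  by rewrite -(subrK w z); apply: ymax; rewrite in_itv /=; lra.
have h2 : x + w <= q i.
  apply: (active_ge_left_max x_gt _ gi') => z zx.
  by rewrite -(subrK w z); apply: xmax; rewrite in_itv /=; lra.
(* Both maxima are tops here, so the heights agree, and a distance of at most [T] contradicts
   [sep]. *)
have := sep i k; lra.
Qed.

End tents.

(** * Periodic families of tents *)

Lemma exists_lattice_dist (R : realType) (L : R) : 0 < L ->
  exists d : R -> R, (forall x (m : int), d x <= `|x - m%:~R * L|) /\
    (forall x, exists m : int, d x = `|x - m%:~R * L|).
Proof.
(* Rounding [x / L] to a nearest integer: every other multiple of [L] is at distance at least
   [L / 2]. *)
move=> L0; pose k x : int := Num.floor (x / L + 2^-1).
exists (fun x => `|x - (k x)%:~R * L|); split=> x; last by exists (k x).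
move=> m; have [->//|mk] := eqVneq m (k x).
have := floor_itv (x / L + 2^-1); rewrite -/(k x) intrD => /andP[k1 k2].
have xL : x / L * L = x by rewrite mulfVK// gt_eqF.
have h1 : ((k x)%:~R - 2^-1) * L <= x by rewrite -[leRHS]xL ler_pM2r//; lra.
have h2 : x <= ((k x)%:~R + 2^-1) * L by rewrite -[leLHS]xL ler_pM2r//; lra.
have : `|x - (k x)%:~R * L| <= 2^-1 * L by rewrite ler_norml; lra.
have [lt_mk|lt_km|/eqP] := ltgtP m (k x); last by rewrite (negbTE mk).
- have : (m%:~R + 1) * L <= (k x)%:~R * L.
    by rewrite ler_pM2r// -(intrD _ m 1) ler_int lezD1.
  have := ler_norm (x - m%:~R * L); lra.
- have : ((k x)%:~R + 1) * L <= m%:~R * L.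
    by rewrite ler_pM2r// -(intrD _ (k x) 1) ler_int lezD1.
  have := ler_norm (m%:~R * L - x); rewrite distrC; lra.
Qed.

(** The infinitely many tents with the same [j] have the envelope [a j - d (x - p j)], with [d] the
    distance to the multiples of [L]. Only a maximum of finitely many functions remains, and it is
    attained. *)
Lemma exists_tent_envelope (R : realType) (L : R) n (p a : 'I_n.+1 -> R) :
  0 < L -> exists g : R -> R,
    (forall (i : 'I_n.+1 * int) x,
        a i.1 - `|x - (p i.1 + i.2%:~R * L)| <= g x) /\
    (forall x, exists i : 'I_n.+1 * int,
        g x = a i.1 - `|x - (p i.1 + i.2%:~R * L)|).
Proof.
move=> /exists_lattice_dist[d [d_le d_att]].
pose f x j := a j - d (x - p j).
exists (fun x => f x [arg max_(j > ord0) f x j]%O); split.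
- move=> [j m] x /=; case: arg_maxP => // k _ /(_ j isT).
  by apply: le_trans; rewrite lerB// opprD addrA.
- move=> x; set j := [arg max_(_ > _) _]%O; have [m dm] := d_att (x - p j).
  by exists (j, m); rewrite /f dm opprD addrA.
Qed.

(** Translation by [L] permutes the tents, moving the integer index by one. *)
Lemma tent_envelope_periodic (R : realType) (L : R) n (p a : 'I_n -> R) g :
  (forall (i : 'I_n * int) x,
        a i.1 - `|x - (p i.1 + i.2%:~R * L)| <= g x) ->
  (forall x, exists i : 'I_n * int,
        g x = a i.1 - `|x - (p i.1 + i.2%:~R * L)|) ->
  forall x, g (x + L) = g x.
Proof.
move=> g_le g_att x; apply/eqP; rewrite eq_le; apply/andP; split.
- have [[j m] /= ->] := g_att (x + L); have /= := g_le (j, m - 1) x.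
  rewrite (_ : x - (p j + (m - 1)%:~R * L) = x + L - (p j + m%:~R * L))//.
  by rewrite intrB; ring.
- have [[j m] /= ->] := g_att x; have /= := g_le (j, m + 1) (x + L).
  rewrite (_ : x + L - (p j + (m + 1)%:~R * L) = x - (p j + m%:~R * L))//.
  by rewrite intrD; ring.
Qed.

(** * Uniform measure of periodic sets *)

Section translation.
Variable R : realType.
Local Notation mu := (@lebesgue_measure R).

Lemma measurable_addr (h : R) :
  measurable_fun [set: R] (fun x : R => x + h : measurableTypeR R).
Proof. exact: measurable_funD. Qed.

Lemma measurable_preimage_addr (h : R) (A : set R) : measurable A ->
  measurable [set x | A (x + h)].
Proof.
by move=> mA; rewrite -[X in measurable X]setTI; exact: measurable_addr.
Qed.

Lemma lebesgue_measure_translate (h : R) (A : set R) : measurable A ->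
  mu [set x | A (x + h)] = mu A.
Proof.
move=> mA.
rewrite -[LHS]/(pushforward mu (fun x : R => x + h : measurableTypeR R) A).
apply/esym; apply: lebesgue_measure_unique => //; first exact: measurable_addr.
move=> mh _ [[a b] /= _ <-]; rewrite /pushforward /=.
have -> : (fun x => x + h) @^-1` [set` `]a, b]] = [set` `]a - h, b - h]].
  by apply/seteqP; split=> x /=; rewrite !in_itv /= ltrBlDr lerBrDr.
rewrite !lebesgue_measure_itv /= !lte_fin ltrD2r.
by case: ifP => // _; rewrite -!EFinB; congr EFin; ring.
Qed.
End translation.

Section periodic.
Variables (R : realType) (L : R).
Hypothesis L0 : 0 < L.
Local Notation mu := (@lebesgue_measure R).
Local Notation P := (uniform_prob L0).

(** The half-open interval is a fundamental domain for the translations by multiples of [L];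
    dropping the end point [L] costs a null set. *)
Lemma uniform_probE (A : set R) : measurable A ->
  P A = ((L^-1)%:E * mu (A `&` [set` `[0%R, L[]))%E.
Proof.
move=> mA; rewrite /uniform_prob integral_uniform_pdf.
rewrite (eq_integral (fun=> (L^-1)%:E)); last first.
  move=> x; rewrite inE => -[_] /=.
  by rewrite in_itv /= /uniform_pdf subr0 => ->.
rewrite integral_cst; last exact: measurableI.
congr (_ * _)%E; rewrite -(setUitv1 true) ?bnd_simp ?ltW// setIUr.
rewrite measureU0//; try exact: measurableI.
by apply: (subset_measure0 _ _ (@subIsetr _ _ _)) => //;
  [exact: measurableI|exact: lebesgue_measure_set1].
Qed.

Definition periodic (A : set R) := forall x, A (x + L) <-> A x.

Lemma periodic_int (A : set R) : periodic A ->
  forall (m : int) x, A (x + m%:~R * L) <-> A x.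
Proof.
move=> pA; have pn (k : nat) x : A (x + k%:R * L) <-> A x.
  elim: k => [|k IH]; first by rewrite mul0r addr0.
  by rewrite -natr1 mulrDl mul1r addrA pA.
case=> k x; first exact: pn.
by rewrite -(pn k.+1) NegzE mulrNz mulNr subrK.
Qed.

Lemma int_translate (x : R) : exists m : int, 0 <= x + m%:~R * L < L.
Proof.
exists (- Num.floor (x / L)); rewrite mulrNz mulNr subr_ge0.
rewrite -ler_pdivlMr// floor_le /=.
have := floorD1_gt (x / L); rewrite ltr_pdivrMr// intrD mulrDl mul1r.
lra.
Qed.

Lemma uniform_periodic_translate (h : R) (A : set R) : measurable A ->
  periodic A -> P [set x | A (x + h)] = P A.
Proof.
move=> mA pA; have [m] := int_translate h; set r := _ + _ => /andP[r0 rL].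
have -> : [set x | A (x + h)] = [set x | A (x + r)].
  by apply/seteqP; split=> x /=; rewrite addrA periodic_int.
rewrite !uniform_probE//; last exact: measurable_preimage_addr.
congr (_ * _)%E.
have mr := measurable_preimage_addr.
(* Points that [+ r] carries past [L] are brought back by [- L]: the fundamental domain is cut in
   two pieces, which are exchanged. *)
have -> : [set x | A (x + r)] `&` `[0, L[ =
    [set x | (A `&` `[r, L[) (x + r)] `|`
    [set x | (A `&` `[0, r[) (x + (r - L))].
  apply/seteqP; split=> x /=; rewrite !in_itv /=.
    move=> [Ax x0L]; case: (ltP (x + r) L) => xr; [left|right].
      by split=> //; lra.
    split; last lra.
    by apply/pA; rewrite (_ : _ + L = x + r)//; ring.
  move=> [[Ax xr]|[Ax xr]]; first by split=> //; lra.
  split; last lra.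
  by move/pA: Ax; rewrite (_ : _ + L = x + r)//; ring.
have -> : A `&` `[0, L[ = (A `&` `[r, L[) `|` (A `&` `[0, r[).
  rewrite -setIUr eqEsubset; split=> x /=; rewrite !in_itv /=.
    by move=> [Ax x0L]; split=> //; case: (ltP x r) => ?; [right|left]; lra.
  by move=> [Ax x0L]; split=> //; case: x0L; lra.
rewrite !measureU//; try exact: measurableI;
  try (by apply: mr; exact: measurableI).
- by congr (_ + _)%E; apply: lebesgue_measure_translate; exact: measurableI.
- by apply/seteqP; split=> x //= [[_ +] [_ +]]; rewrite !in_itv /=; lra.
- by apply/seteqP; split=> x //= [[_ +] [_ +]]; rewrite !in_itv /=; lra.
Qed.

Definition orbit_set (S : set R) := [set w | exists m : int, S (w + m%:~R * L)].

Lemma measurable_orbit_set S : measurable S -> measurable (orbit_set S).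
Proof.
move=> mS; rewrite (_ : orbit_set S =
   \bigcup_(m : int) [set w | S (w + m%:~R * L)]).
  apply: countable_bigcupT_measurable => // m.
  exact: measurable_preimage_addr.
by apply/seteqP; split=> w [m]; [exists m|move=> _; exists m].
Qed.

Lemma periodic_orbit_set S : periodic (orbit_set S).
Proof.
move=> x; split=> -[m Sx].
  by exists (1 + m); rewrite intrD mulrDl mul1r addrA.
exists (m - 1); rewrite (_ : x + L + _ = x + m%:~R * L)//.
by rewrite intrB; ring.
Qed.

Lemma orbit_set_fundamental S : S `<=` [set` `[0, L[] ->
  orbit_set S `&` [set` `[0, L[] = S.
Proof.
move=> SL; apply/seteqP; split=> w; last first.
  move=> Sw; split; last exact: SL.
  by exists 0; rewrite mul0r addr0.
move=> [[m Sw]]; have := SL _ Sw; rewrite /= !in_itv /= => h1 h2.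
suff m0 : m = 0 by move: Sw; rewrite m0 mul0r addr0.
apply/eqP; rewrite eq_le; apply/andP; split.
  rewrite -ltzD1 add0r -(ltr_int R) -(ltr_pM2r L0); lra.
rewrite -ltzD1 -(ltr_int R) intrD -(ltr_pM2r L0) mulrDl; lra.
Qed.

(** Each of the [n] shifted orbit sets has probability [mu S / L] by translation invariance, and the
    last hypothesis makes them disjoint. *)
Lemma uniform_orbits (n : nat) (c : 'I_n -> R) (S : set R) :
  measurable S -> S `<=` `[0, L[ ->
  (forall i j w (m k : int), S (w + c i + m%:~R * L) ->
      S (w + c j + k%:~R * L) -> i = j) ->
  let B := [set w | exists i (m : int), S (w + c i + m%:~R * L)] in
  measurable B /\ P B = ((L^-1 * n%:R)%:E * mu S)%E.
Proof.
move=> mS SL inj B; pose F i := [set w | orbit_set S (w + c i)].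
have mF i : measurable (F i).
  by apply: measurable_preimage_addr; exact: measurable_orbit_set.
have BE : B = \big[setU/set0]_(i < n) F i.
  rewrite -bigcup_seq; apply/seteqP; split=> w [i].
    by move=> [m Sm]; exists i; [exact: mem_index_enum|exists m].
  by move=> _ [m Sm]; exists i, m.
have PF i : P (F i) = ((L^-1)%:E * mu S)%E.
  rewrite uniform_periodic_translate; last exact: periodic_orbit_set.
    rewrite uniform_probE ?orbit_set_fundamental//.
    exact: measurable_orbit_set.
  exact: measurable_orbit_set.
split; first by rewrite BE; apply: bigsetU_measurable.
rewrite BE (measure_bigsetU_ord _ xpredT)//.
  rewrite (eq_bigr _ (fun i _ => PF i)) big_const_ord iter_addr addr0.
  transitivity (n%:R%:E * (L^-1%:E * mu S))%E; first by rewrite mule_natl.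
  by rewrite muleA -EFinM [(_ * L^-1)%R]mulrC.
apply/trivIsetP => i j _ _ ij; apply/seteqP; split=> // w [[m Sm] [k Sk]].
by move/eqP : ij; apply; exact: inj Sm Sk.
Qed.
End periodic.

(** * The randomly shifted function *)

Section random_shift.
Variables (R : realType) (L : R) (L0 : 0 < L) (g : R -> R).
Hypotheses (gc : continuous g) (gL : forall x, g (x + L) = g x).
Local Notation P := (uniform_prob L0).

Lemma measurable_shift (s : R) :
  measurable_fun [set: measurableTypeR R]
    (fun w : measurableTypeR R => g (s + w) : R).
Proof.
apply: (@continuous_measurable_fun _ (fun w => g (s + w))) => w.
apply: continuous_comp; last exact: gc.
by apply: cvgD; [exact: cvg_cst|exact: cvg_id].
Qed.

Definition random_shift (s : R) : {RV P >-> R} :=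
  HB.pack (fun w => g (s + w))
    (isMeasurableFun.Build _ _ _ _ _ (measurable_shift s)).
Local Notation X := random_shift.

Lemma random_shift_continuous : sample_continuous X.
Proof.
move=> w s; apply: (@continuous_comp _ _ _ (fun s => s + w) g); last exact: gc.
by apply: cvgD; [exact: cvg_id|exact: cvg_cst].
Qed.

(** A time shift by [h] is a translation of [w] by [h], under which the uniform law is invariant on
    [L]-periodic events. *)
Lemma random_shift_stationary : stationary X.
Proof.
move=> n s h A mA; rewrite /fdd /pushforward.
pose phi (w : R) := [tuple X (s i) w | i < n].
have mphi : measurable_fun [set: R] phi.
  apply/measurable_fun_tnthP => i.
  rewrite (_ : _ \o _ = fun w => g (s i + w)); first exact: measurable_shift.
  by apply/funext => w; rewrite /= tnth_mktuple.
rewrite -/(phi @^-1` A).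
have mB : measurable (phi @^-1` A).
  by rewrite -[X in measurable X]setTI; exact: mphi.
rewrite -[RHS](uniform_periodic_translate L0 h mB); last first.
  move=> w; rewrite /preimage /= (_ : phi (w + L) = phi w)//.
  by apply: eq_from_tnth => i; rewrite !tnth_mktuple /= addrA gL.
congr (P _); apply/seteqP; split=> w /=.
all: rewrite (_ : [tuple X (s i + h) w | i < n] = phi (w + h))//.
all: by apply: eq_from_tnth => i; rewrite !tnth_mktuple /= -addrA (addrC w).
Qed.

Lemma argsup_random_shift T w s : 0 <= T ->
  argsup X T w s <-> window_max g T w s.
Proof.
move=> T0; have fc : {within `[0, T], continuous (fun s => X s w)}.
  by apply: continuous_subspaceT => x; exact: random_shift_continuous.
have [c cT cmax] := EVT_max T0 fc.
have ubX : ubound [set X s' w | s' in [set` `[0, T]]] (X c w).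
  by move=> _ [s' s'T <-]; exact: cmax.
split=> -[sT smax]; split=> //.
  move=> s' s'T; rewrite -[leRHS]/(X s w) smax.
  by apply: ub_le_sup; [exists (X c w)|exists s'].
apply/eqP; rewrite eq_le; apply/andP; split.
  by apply: ub_le_sup; [exists (X c w)|exists s].
apply: ge_sup; first by exists (X c w), c.
by move=> _ [s' s'T <-]; exact: smax.
Qed.

Lemma sup_location_random_shift T w : 0 <= T ->
  window_max g T w (sup_location X T w) /\
  forall s, window_max g T w s -> sup_location X T w <= s.
Proof.
move=> T0; have [m l] :=
  @sup_location_min _ _ _ _ X T w T0 random_shift_continuous.
by split=> [|s ms]; [exact/argsup_random_shift|exact/l/argsup_random_shift].
Qed.

End random_shift.

(** * The process of an envelope of tents *)

(** Tent [k] reaches the level [a i] only within distance [a k - a i] of [q k]. By hypothesis this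
    interval is empty or misses the window, so the top of tent [i], at time [s], is the only
    maximum. *)
Lemma dominant_window_max (R : realType) (I : eqType) (q a : I -> R)
    (g : R -> R) i (T s : R) :
  (forall i x, a i - `|x - q i| <= g x) ->
  (forall x, exists i, g x = a i - `|x - q i|) ->
  0 <= s <= T ->
  (forall k, k != i -> [\/ a k < a i, q k + (a k - a i) < q i - s |
      q i + (T - s) < q k - (a k - a i)]) ->
  window_max g T (q i - s) s /\
  forall s', window_max g T (q i - s) s' -> s' = s.
Proof.
move=> g_le g_att sT dom.
(* The first alternative keeps the exact loss along tent [i], from which uniqueness follows. *)
have lt_top s' : s' \in `[0, T] -> g (s' + (q i - s)) + `|s' - s| <= a i \/
    g (s' + (q i - s)) < a i.
  rewrite in_itv /= => s'T; have [k ->] := g_att (s' + (q i - s)).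
  have [->|/dom d] := eqVneq k i.
    by left; rewrite (_ : s' + (q i - s) - q i = s' - s) ?subrK//; ring.
  have := lexx `|s' + (q i - s) - q k|; rewrite ler_norml => /andP[? ?].
  by right; case: d; lra.
have top : g (s + (q i - s)) = a i.
  rewrite subrKC; apply/eqP; rewrite eq_le; apply/andP; split; last first.
    by have := g_le i (q i); rewrite subrr normr0 subr0.
  have := lt_top s; rewrite in_itv /= sT subrKC subrr normr0 addr0.
  by move=> /(_ isT)[//|/ltW].
split.
  split; first by rewrite in_itv.
  move=> s' /lt_top; rewrite top; have := normr_ge0 (s' - s); lra.
move=> s' [s'T s'max]; have := s'max s; rewrite in_itv /= sT top => /(_ isT).
have [h h'|] := lt_top _ s'T; last by rewrite ltNge => /negbTE ->.
apply/eqP; rewrite -subr_eq0 -normr_le0; lra.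
Qed.

Section tent_process.
Variables (R : realType) (L delta : R) (L0 : 0 < L) (n : nat) (p a : 'I_n -> R).
Variables (g : R -> R) (gc : continuous g).
Local Notation I := ('I_n * int)%type.
Local Notation q i := (p i.1 + i.2%:~R * L).
Hypothesis g_le : forall (i : I) x, a i.1 - `|x - q i| <= g x.
Hypothesis g_att : forall x, exists i : I, g x = a i.1 - `|x - q i|.
Hypothesis delta_gt0 : 0 < delta.
Hypothesis delta_le : delta <= L.
Hypothesis q_sep : forall i k : I, i != k -> delta <= `|q i - q k|.
Local Notation P := (uniform_prob L0).
Local Notation X := (random_shift L0 gc).
Local Notation Xcont := (@random_shift_continuous _ _ L0 _ gc).
Local Notation mu := (@lebesgue_measure R).

(** Peaks are at least [delta] apart and [S] fits in an interval of length at most [delta], so the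
    orbits belonging to different [j] are disjoint. *)
Lemma uniform_near_peak (c e : R) (S : set R) : e <= delta ->
  measurable S -> S `<=` [set` `[0, e[] ->
  let B := [set w | exists i : I, S (w + c - q i)] in
  measurable B /\ P B = ((L^-1 * n%:R)%:E * mu S)%E.
Proof.
move=> ed mS Se B.
have -> : B =
    [set w | exists (j : 'I_n) (m : int), S (w + (c - p j) + m%:~R * L)].
  apply/seteqP; split=> w.
    move=> [[j m] /= Sw]; exists j, (- m); congr (S _): Sw.
    by rewrite mulrNz; ring.
  move=> [j [m Sw]]; exists (j, - m); congr (S _): Sw.
  by rewrite /= mulrNz; ring.
apply: uniform_orbits => //.
  move=> x /Se /=; rewrite !in_itv /= => /andP[-> h] /=.
  exact: lt_le_trans h (le_trans ed delta_le).
move=> i j w m k /Se /= + /Se /=; rewrite !in_itv /= => h1 h2.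
apply/eqP; apply: contraT => ij.
have := @q_sep (i, - m) (j, - k); rewrite xpair_eqE (negbTE ij) /= => /(_ isT).
rewrite /= leNgt ltr_norml !mulrNz => /negP; case; lra.
Qed.

(** By [two_window_max], a shift [w] with two maxima takes one of three values attached to a pair of
    tents, and there are countably many pairs. *)
Lemma tent_process_U (T : R) : injective a -> 0 <= T < L -> assumption_U X T.
Proof.
move=> a_inj /andP[T0 TL].
pose bad (ik : I * I) : set R := [set (q ik.1 + a ik.1.1 - a ik.2.1);
  (q ik.2 - T + a ik.1.1 - a ik.2.1);
  (a ik.1.1 + q ik.1 - a ik.2.1 + q ik.2 - T) / 2].
pose N := \bigcup_ik bad ik.
have cN : countable N.
  apply: bigcup_countable; first exact: countableP.
  move=> ik _; apply: finite_set_countable.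
  by rewrite /bad !finite_setU; do !split; exact: finite_set1.
have mN : measurable N by apply: countable_measurable.
exists N; split=> //.
  rewrite /= uniform_probE//.
  rewrite (_ : mu _ = 0%E) ?mule0//; apply: countable_lebesgue_measure0.
  exact: sub_countable (subset_card_le (@subIsetl _ _ _)) cN.
move=> w /=; apply: contra_notP => Nw.
have [m1 _] := sup_location_random_shift L0 gc w T0.
set s := sup_location X T w in m1 *.
exists s; split=> [|s' m2]; first exact/argsup_random_shift.
apply/eqP; apply: contra_notT Nw => neq_ss'.
(* Tents of equal height are translates of each other by a multiple of [L], and [L] exceeds [T]. *)
have sep (i k : I) : a i.1 = a k.1 -> q i < q k -> T < q k - q i.
  move=> /a_inj ->; rewrite ltrD2l ltr_pM2r// ltr_int => lt_ik.
  apply: (lt_le_trans TL); rewrite opprD addrACA subrr add0r -mulrBl -intrB.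
  by rewrite -[leLHS]mul1r ler_pM2r// ler1z -gtz0_ge1 subr_gt0.
have wit (i k : I) : [\/ w = q i + a i.1 - a k.1, w = q k - T + a i.1 - a k.1 |
     w = (a i.1 + q i - a k.1 + q k - T) / 2] -> N w.
  move=> h; exists (i, k) => //=.
  by case: h => ->; [left; left|left; right|right].
move/(argsup_random_shift L0 gc _ _ T0) in m2.
have [lt|lt|/eqP] := ltgtP s s'; last by rewrite (negbTE neq_ss').
- by have [i [k /wit]] := two_window_max g_le g_att lt m1 m2 sep.
- by have [i [k /wit]] := two_window_max g_le g_att lt m2 m1 sep.
Qed.

(** The local maxima are exactly the peaks, so for [e] at most [delta] the probability equals
    [e n / L] and the quotient is constant. *)
Lemma tent_process_L :
  (forall i : I, \forall x \near q i, g x <= g (q i)) -> assumption_L X.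
Proof.
move=> top.
have E : \forall e \near 0^'+,
    ((e^-1)%:E * P (has_local_max_in X 0 e))%E = (L^-1 * n%:R)%:E.
  near=> e; have e0 : 0 < e by near: e; exact: nbhs_right_gt.
  have ed : e <= delta by near: e; exact: nbhs_right_le.
  (* A peak at time [q i - w] is recorded by its distance [w + e - q i] to the right end of the
     interval. *)
  have -> : has_local_max_in X 0 e =
      [set w | exists i : I, [set` `]0, e[] (w + e - q i)].
    apply/seteqP; split=> w /=.
      move=> [u ue /nbhs_ballP[r /= r0 umax]].
      have /(local_max_tent g_le g_att)[i [ui _]] :
          \forall x \near u + w, g x <= g (u + w).
        apply/nbhs_ballP; exists r => // x xu; rewrite -(subrK w x).
        apply: umax; move: xu; rewrite /ball /=.
        by rewrite (_ : u + w - x = u - (x - w))//; ring.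
      by exists i; rewrite in_itv /= -ui; lra.
    move=> [i]; rewrite in_itv /= => ie; exists (q i - w); first lra.
    have /nbhs_ballP[r /= r0 imax] := top i.
    apply/nbhs_ballP; exists r => // x xu /=; rewrite subrK.
    apply: imax; move: xu; rewrite /ball /=.
    by rewrite (_ : q i - w - x = q i - (x + w))//; ring.
  have [//||_ ->] := @uniform_near_peak e e [set` `]0, e[] ed.
    by move=> x /=; rewrite !in_itv /=; lra.
  rewrite lebesgue_measure_itv /= lte_fin e0 -EFinB subr0 -!EFinM.
  by congr EFin; field; rewrite !gt_eqF.
have qcvg : ((e^-1)%:E * P (has_local_max_in X 0 e))%E @[e --> 0^'+] -->
    (L^-1 * n%:R)%:E by exact: cvg_near_cst E.
 split; first exact: cvgP qcvg.
by rewrite (cvg_lim _ qcvg)// ltry.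
Unshelve. all: by end_near. Qed.

(** This provides the measurability behind the distribution function. If the leftmost maximum lies
    beyond [x], the maximum over [[0, x]] is strictly smaller, and the Lipschitz bound preserves
    this for nearby shifts. *)
Lemma closed_sup_location_le (T x : R) : 0 <= x <= T ->
  closed [set w | sup_location X T w <= x].
Proof.
move=> /andP[x0 xT]; have T0 : 0 <= T := le_trans x0 xT.
have tau v := sup_location_random_shift L0 gc v T0.
have lt_near (w : R) : x < sup_location X T w ->
    exists2 e : R, 0 < e &
      forall v : R, `|w - v| < e -> x < sup_location X T v.
  move=> x_lt; have fc : {within `[0, x], continuous (fun s => X s w)}.
    by apply: continuous_subspaceT => y; exact: Xcont.
  have [z zx zmax] := EVT_max x0 fc; rewrite /= in zmax.
  have [[rT rmax] r_min] := tau w.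
  set r := sup_location X T w in x_lt rT rmax r_min.
  have zlt : g (z + w) < g (r + w).
    rewrite ltNge; apply/negP => le_z.
    suff /r_min : window_max g T w z by move: zx; rewrite in_itv /=; lra.
    split; first by move: zx; rewrite !in_itv /=; lra.
    by move=> s' /rmax /le_trans; apply.
  (* Half the gap, since each of the two compared values moves by at most [|w - v|]. *)
  exists ((g (r + w) - g (z + w)) / 2); first lra.
  move=> v wv; rewrite ltNge; apply/negP => vx.
  have [[vT vmax] _] := tau v; set s := sup_location X T v in vx vT vmax.
  have h1 := vmax _ rT.
  have := zmax s; rewrite in_itv /= vx andbT.
  move: vT; rewrite in_itv /= => /andP[-> _] /(_ isT) h2.
  have := tent_lipschitz g_le g_att (r + w) (r + v).
  have := tent_lipschitz g_le g_att (s + v) (s + w).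
  rewrite !(opprD r) !(opprD s) !(addrACA _ _ (- r)) !(addrACA _ _ (- s)).
  by rewrite !subrr !add0r (distrC v w); lra.
move=> w clw /=; rewrite leNgt; apply/negP => /lt_near[e e0 lt_x].
have [v [/= vx wv]] := clw _ (nbhsx_ballx w _ e0).
by have := lt_x v wv; rewrite ltNge vx.
Qed.

(** The location falls in []t, t + h]] exactly when some peak does: an interior maximum is a top,
    and a peak at such a time is the unique maximum. This event has probability [h n / L]. *)
Lemma tent_process_density (T t h0 : R) : 0 < t -> 0 < h0 -> h0 <= delta ->
  t + h0 < T ->
  (forall (i : I) s, t < s <= t + h0 -> window_max g T (q i - s) s /\
     forall s', window_max g T (q i - s) s' -> s' = s) ->
  \forall h \near 0^'+, sup_location_rdiff X T t h = L^-1 * n%:R.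
Proof.
move=> t0 h00 h0d hT dom; near=> h.
have h_gt0 : 0 < h by near: h; exact: nbhs_right_gt.
have hh0 : h <= h0 by near: h; exact: nbhs_right_le.
have T0 : 0 <= T by lra.
have E : [set w | sup_location X T w <= t + h] =
   [set w | sup_location X T w <= t] `|`
   [set w | exists i : I, [set` `[0, h[] (w + (t + h) - q i)].
  apply/seteqP; split=> w /=.
    move=> wth; case: (leP (sup_location X T w) t) => wt; [by left|right].
    have [m _] := sup_location_random_shift L0 gc w T0.
    have [|i [qi _]] := window_max_interior g_le g_att _ m; first lra.
    by exists i; rewrite in_itv /= -qi; lra.
  move=> [wt|[i]]; first lra.
  rewrite in_itv /= => ih.
  have [|wm wu] := dom i (q i - w); first lra.
  have [m _] := sup_location_random_shift L0 gc w T0.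
  by rewrite subKr in wu; rewrite (wu _ m); lra.
have mA : measurable [set w | sup_location X T w <= t].
  by apply: closed_measurable; apply: closed_sup_location_le; lra.
have [//|mB PB] := @uniform_near_peak (t + h) h [set` `[0, h[]
  (le_trans hh0 h0d) _ (@subset_refl _ _).
rewrite /sup_location_rdiff /sup_location_cdf /sup_location_law /pushforward.
have F x : sup_location X T @^-1` [set` `]-oo, x]] =
    [set w | sup_location X T w <= x].
  by apply/seteqP; split=> w /=; rewrite in_itv.
rewrite !F E measureU//; last first.
  apply/seteqP; split=> // w /= [wt [i]]; rewrite in_itv /= => ih.
  have [|wm wu] := dom i (q i - w); first lra.
  have [m _] := sup_location_random_shift L0 gc w T0.
  by rewrite subKr in wu; move: wt; rewrite (wu _ m); lra.
rewrite [X in fine (_ + X)]PB lebesgue_measure_itv /= lte_fin h_gt0 -EFinB.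
rewrite subr0 -EFinM.
rewrite fineD// ?fin_num_measure//. rewrite [X in X - _]addrC addrK /=.
by field; rewrite !gt_eqF.
Unshelve. all: by end_near. Qed.

End tent_process.

(** With [N = n.+1] the second inequality amounts to [c T < N (1 - c delta)], which holds for large
    [N] once [c delta < 1]. *)
Lemma exists_comb_parameters (R : realType) (r T c : R) : 0 < r -> 0 < T ->
  c < r^-1 -> exists (delta : R) (n : nat),
    r < delta /\ c < (n.+1%:R * delta + T)^-1 * n.+1%:R.
Proof.
move=> r0 T0 cr.
have [delta rd cd] : exists2 delta, r < delta & c * delta < 1.
  (* For positive [c] the midpoint of [r] and [1 / c] serves; otherwise any [delta > r] does. *)
  have [c0|c0] := ltP 0 c.
    have cr1 : c * r < 1 by rewrite -ltr_pdivlMr// mul1r.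
    exists ((r + c^-1) / 2).
      have : r < c^-1 by rewrite -[c^-1]mul1r ltr_pdivlMr// mulrC.
      lra.
    by rewrite mulrA mulrDr mulfV ?gt_eqF//; lra.
  by exists (r + 1); nra.
have d0 := lt_trans r0 rd.
pose n := Num.truncn (`|c * T / (1 - c * delta)|).
exists delta, n; split=> //; rewrite mulrC ltr_pdivlMr; last first.
  by rewrite addr_gt0// mulr_gt0.
have : c * T / (1 - c * delta) < n.+1%:R.
  apply: le_lt_trans (ler_norm _) _.
  by have /andP[_] := truncn_itv (normr_ge0 (c * T / (1 - c * delta))).
rewrite ltr_pdivrMr; last lra.
lra.
Qed.

(** * The comb *)

Section comb.
Variables (R : realType) (T t r delta : R) (n : nat).
Hypotheses (tT : 0 < t < T) (r_delta : r < delta) (r_gt0 : 0 < r).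
Let N := n.+1.
Let L := N%:R * delta + T.
(** One third of the slack [delta - r] bounds the height differences and one third the time past
    [t]; the last third keeps inequalities strict. [h0] also keeps [t + h0] below [T]. *)
Let kappa := (delta - r) / 3.
Let h0 := Num.min kappa ((T - t) / 2).
Let p (j : 'I_N) := j%:R * delta.
Variable a : 'I_N -> R.
Hypothesis a_close : forall j k, a j - a k <= kappa.
Hypothesis a_mono : (r = t /\ forall j k : 'I_N, (j < k)%N -> a k < a j) \/
  (r = T - t /\ forall j k : 'I_N, (j < k)%N -> a j < a k).
Local Notation q i := (p i.1 + i.2%:~R * L).
Implicit Types i k : ('I_N * int)%type.

Lemma comb_next_tooth (j j' : 'I_N) (m : int) : (j < j')%N ->
  q (j, m) + delta <= q (j', m).
Proof.
move=> jj; rewrite /= /p; have : (j.+1%:R : R) <= j'%:R by rewrite ler_nat.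
have dpos : 0 < delta := lt_trans r_gt0 r_delta.
rewrite -natr1 => h; have : (j%:R + 1) * delta <= j'%:R * delta.
  by rewrite ler_pM2r//.
lra.
Qed.

(** The last tooth of a period sits at [(N - 1) delta] and the period is [N delta + T], which leaves
    a gap of [T + delta]. *)
Lemma comb_next_period i k : (i.2 < k.2)%R -> q i + (T + delta) <= q k.
Proof.
case: i k => [j m] [j' m'] /= mm; rewrite /p.
have dpos : 0 < delta := lt_trans r_gt0 r_delta.
have Lpos : 0 < L.
  by rewrite addr_gt0 ?mulr_gt0//; case/andP: tT; exact: lt_trans.
have : (m%:~R + 1) * L <= m'%:~R * L.
  by rewrite ler_pM2r// -(intrD _ m 1) ler_int lezD1.
have : (j%:R + 1) * delta <= N%:R * delta by rewrite ler_pM2r// natr1 ler_nat.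
have : 0 <= j'%:R * delta by rewrite mulr_ge0// ltW.
rewrite mulrDl mul1r => h1 h2; rewrite mulrDl mul1r {2}/L; lra.
Qed.

Lemma comb_position i k : k != i ->
  [\/ q k + (T + delta) <= q i, q i + (T + delta) <= q k,
      q k + delta <= q i /\ (k.1 < i.1)%N |
      q i + delta <= q k /\ (i.1 < k.1)%N].
Proof.
case: i k => [j m] [j' m']; rewrite xpair_eqE negb_and.
have [mm _|mm _|->] := ltgtP m m'.
- by apply: Or42; exact: comb_next_period.
- by apply: Or41; exact: comb_next_period.
rewrite orbF -val_eqE /=; have [jj _|jj _|//] := ltngtP j j'.
- by apply: Or44; split=> //; exact: comb_next_tooth.
- by apply: Or43; split=> //; exact: comb_next_tooth.
Qed.

Lemma comb_separated i k : i != k -> delta <= `|q i - q k|.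
Proof.
have := lexx `|q i - q k|; rewrite ler_norml => /andP[? ?].
move: (tT) => ?; move=> /comb_position; case=> [||[+ _]|[+ _]]; lra.
Qed.

Lemma comb_dominant i s : t < s <= t + h0 -> forall k, k != i ->
  [\/ a k.1 < a i.1, q k + (a k.1 - a i.1) < q i - s |
      q i + (T - s) < q k - (a k.1 - a i.1)].
Proof.
move=> sh k ki; have := a_close k.1 i.1.
have h0k : h0 <= kappa by rewrite ge_min lexx.
have h0T : h0 <= (T - t) / 2 by rewrite ge_min lexx orbT.
have kd : kappa = (delta - r) / 3 by [].
move: (tT) (r_delta) (r_gt0) => tT' rd r0.
move: (q k) (q i) (comb_position ki) => qk qi pos ak.
case: pos => [kqi|iqk|[kqi ji]|[iqk ij]].
- by apply: Or32; lra.
- by apply: Or33; lra.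
- case: a_mono => -[rt mono]; last by apply: Or31; exact: mono.
  by apply: Or32; lra.
- case: a_mono => -[rt mono]; first by apply: Or31; exact: mono.
  by apply: Or33; lra.
Qed.

Lemma comb_heights_injective : injective a.
Proof.
move=> j k ajk; apply/val_inj; have [jk|jk|//] := ltngtP (val j) (val k).
all: by case: a_mono => -[_ /(_ _ _ jk)]; rewrite ajk ltxx.
Qed.

Lemma comb_process : exists (d : measure_display) (Omega : measurableType d)
    (P : probability Omega R) (X : R -> {RV P >-> R}),
  [/\ sample_continuous X, stationary X, assumption_U X T, assumption_L X &
    \forall h \near 0^'+, sup_location_rdiff X T t h = L^-1 * N%:R].
Proof.
have dpos : 0 < delta := lt_trans r_gt0 r_delta.
move: (tT) (r_delta) (r_gt0) => tT' rd r0; have Tpos : 0 < T by lra.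
have Npos : 0 < N%:R * delta by rewrite mulr_gt0.
have L0 : 0 < L by rewrite /L; lra.
have TL : T < L by rewrite /L; lra.
have dL : delta <= L.
  have : 1 * delta <= N%:R * delta by rewrite ler_pM2r// ler1n.
  by rewrite /L; lra.
have [g [g_le g_att]] := exists_tent_envelope p a L0.
have gc := tent_continuous g_le g_att.
have h0pos : 0 < h0 by rewrite lt_min /kappa; lra.
have h0k : h0 <= kappa by rewrite ge_min lexx.
have h0T : h0 <= (T - t) / 2 by rewrite ge_min lexx orbT.
have kd : kappa = (delta - r) / 3 by [].
have dom i s : t < s <= t + h0 -> window_max g T (q i - s) s /\
     forall s', window_max g T (q i - s) s' -> s' = s.
  move=> sh; apply: (dominant_window_max g_le g_att); first lra.
  exact: comb_dominant.
exists _, _, (uniform_prob L0), (random_shift L0 gc); split.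
- exact: random_shift_continuous.
- exact/random_shift_stationary/(tent_envelope_periodic g_le g_att).
- apply: (tent_process_U _ _ g_le g_att comb_heights_injective).
  by rewrite TL ltW.
- apply: (tent_process_L _ _ g_le g_att dpos dL comb_separated) => i.
  (* Each peak is a window maximum at the interior time [t + h0], hence a local maximum. *)
  have [|imax _] := dom i (t + h0); first lra.
  rewrite -(subrKC (t + h0) (q i)).
  by apply: window_max_local_max imax; lra.
- apply: (tent_process_density L0 gc g_le g_att dL comb_separated _ h0pos
    _ _ dom).
  all: lra.
Qed.
End comb.

(** * Choice of the side and of the heights *)

Theorem proposition4p1 (R : realType) (T t c : R) :
  0 < T -> 0 < t < T -> c < Num.max t^-1 (T - t)^-1 ->
  exists (d : measure_display) (Omega : measurableType d)
         (P : probability Omega R) (X : R -> {RV P >-> R}),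
    [/\ sample_continuous X, stationary X, assumption_U X T, assumption_L X &
        cvg (sup_location_rdiff X T t h @[h --> 0^'+]) /\
        c < sup_location_density X T t].
Proof.
move=> T0 tT; rewrite lt_max => cmax.
(* Either of [t] and [T - t] serves as soon as its inverse exceeds [c]; it need not be the smaller
   one. *)
have [r [r0 cr rE]] : exists r : R, [/\ 0 < r, c < r^-1 &
    r = t \/ r = T - t].
  by case/orP: cmax => ?; [exists t|exists (T - t)]; split=> //;
    [lra|left|lra|right].
have [delta [n [rd cn]]] := exists_comb_parameters r0 T0 cr.
(* The step between successive heights, chosen so that their total spread stays within
   [(delta - r) / 3]. *)
pose eta := (delta - r) / 3 / n.+1%:R.
have d3 : 0 < (delta - r) / 3 by lra.
have eta0 : 0 < eta by rewrite divr_gt0.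
(* The sign makes the heights decrease if [r = t] and increase otherwise; when [t = T - t] they
   decrease. *)
pose eps : R := if r == t then -1 else 1.
pose a (j : 'I_n.+1) := eps * (eta * j%:R).
have [||d [W [P [X [Xc Xs XU XL Xd]]]]] :=
  @comb_process R T t r delta n tT rd r0 a.
- move=> j k; rewrite /a -mulrBr.
  have e1 (l : 'I_n.+1) : 0 <= eta * l%:R <= (delta - r) / 3.
    apply/andP; split; first by rewrite mulr_ge0// ltW.
    by rewrite /eta mulrAC ler_pdivrMr// ler_pM2l// ler_nat ltnW.
  have := e1 j; have := e1 k; rewrite /eps; case: ifP => _; lra.
- rewrite /a /eps; case: eqVneq => [rt|rt]; [left|right]; split=> //.
  + by move=> j k jk; rewrite !mulN1r ltrN2 ltr_pM2l// ltr_nat.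
  + by case: rE => // rt'; rewrite rt' eqxx in rt.
  + by move=> j k jk; rewrite !mul1r ltr_pM2l// ltr_nat.
have dcvg : sup_location_rdiff X T t h @[h --> 0^'+] -->
    (n.+1%:R * delta + T)^-1 * n.+1%:R by exact: cvg_near_cst Xd.
exists d, W, P, X; split=> //; split; first exact: cvgP dcvg.
by rewrite /sup_location_density (cvg_lim _ dcvg).
Qed.
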